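(* The functor $\overline{\mathcal{F}}:\mathbf{Hyperfields}_{dd}\to\mathbf{FuzzyRings}_{str}$ is faithful but neither full nor essentially surjective, and the same holds for its composition with the functor $\mathbf{FuzzyRings}_{str}\to\mathbf{FuzzyRings}_{wk}$ that restricts strong morphisms to groups of units. If $H$ is a doubly-distributive hyperfield, $E$ a nonempty finite set and $r$ a positive integer, then applying the identification $H^\times\cong\overline{\mathcal{F}}(H)^\times$, $x\mapsto\{x\}$ (and $0\mapsto\{0\}$) to the components (values) of Grassmann-Plücker functions gives a bijection between rank $r$ matroids on $E$ with coefficients in $H$ and rank $r$ matroids on $E$ with coefficients in the fuzzy ring $\overline{\mathcal{F}}(H)$.
   Context: **Hyperfields.** For a set $A$, $\mathcal{P}^*(A)$ is the set of nonempty subsets of $A$. A hyperoperation on $A$ is a map $+:A\times A\to\mathcal{P}^*(A)$; it extends to $\mathcal{P}^*(A)$ by $X+Y=\bigcup_{x\in X,y\in Y}(x+y)$ (elements are identified with singletons). A canonical hypergroup is a set $A$ with a hyperoperation $+$ such that: $a+b=b+a$; there is an element $0$ with $a+0=\{a\}$ for all $a$; for each $a$ there is a unique $-a\in A$ with $0\in a+(-a)$; $(a+b)+c=a+(b+c)$; and $a\in b+c$ if and only if $c\in a+(-b)$. A hyperring is a set $R$ with a multiplication $\times$ and a hyperoperation $+$ such that $(R,+)$ is a canonical hypergroup, $(R,\times)$ is a unital commutative monoid, $a(b+c)=ab+ac$, and $a\times 0=0$. A hyperfield is a hyperring in which $(R\smallsetminus\{0\},\times)$ is a group. It is doubly-distributive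 if $(a+b)(c+d)=ac+ad+bc+bd$ for all $a,b,c,d$ (where $XY=\{xy\mid x\in X,y\in Y\}$). A strict homomorphism is a map $f$ with $f(0)=0$, $f(1)=1$, $f(ab)=f(a)f(b)$ and $f(a+b)=f(a)+f(b)$. $\mathbf{Hyperfields}_{dd}$ is the category of doubly-distributive hyperfields and strict homomorphisms. **Fuzzy rings.** A fuzzy ring is a tuple $(K;+,\times;\varepsilon,K_0)$ with $K$ a set, $+,\times$ binary operations on $K$, $\varepsilon\in K$, $K_0\subset K$, such that, with $K^\times$ the group of multiplicative units: (FR0) $(K,+)$ and $(K,\times)$ are commutative monoids with neutral elements $0$ and $1$; (FR1) $0\times a=0$ for all $a\in K$; (FR2) $a(b+c)=ab+ac$ for all $b,c\in K$, $a\in K^\times$; (FR3) $\varepsilon^2=1$; (FR4) $K_0+K_0\subseteq K_0$, $K\times K_0\subseteq K_0$, $0\in K_0$, $1\notin K_0$; (FR5) for $a\in K^\times$, $1+a\in K_0$ if and only if $a=\varepsilon$; (FR6) if $a+b\in K_0$ and $c+d\in K_0$ then $ac+\varepsilon bd\in K_0$; (FR7) if $a+b(c+d)\in K_0$ then $a+bc+bd\in K_0$. A strong morphism $K\to L$ is a map $f:K\to L$ with $f(1)=1$, $f(0)=0$, $f(a\times b)=f(a)\times f(b)$ for all $a\in K^\times$, $b\in K$, and such that for all $a_i,b_i\in K$, if $\sum_{i=1}^n a_i\times b_i\in K_0$ then $\sum_{i=1}^n f(a_i)\times f(b_i)\in L_0$. A weak morphism $K\to L$ is a group homomorphism $f:K^\times\to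 L^\times$ such that for all $a_1,\dots,a_n\in K^\times$, if $\sum a_i\in K_0$ then $\sum f(a_i)\in L_0$. $\mathbf{FuzzyRings}_{str}$ and $\mathbf{FuzzyRings}_{wk}$ are the categories of fuzzy rings with strong, resp. weak, morphisms. **The functor $\overline{\mathcal{F}}$.** For a doubly-distributive hyperfield $H$, let $S(H)$ be the set of all subsets of $H$ of the form $\sum_{i=1}^n a_i$ (finite hypersums, $a_i\in H$, $n\ge1$). $\overline{\mathcal{F}}(H)$ is the fuzzy ring with underlying set $S(H)$, $A+B=\bigcup_{a\in A,b\in B}(a+b)$, $A\times B=\{ab\mid a\in A,b\in B\}$, $\varepsilon=\{-1_H\}$, $0=\{0_H\}$, $1=\{1_H\}$, null set $\{A\in S(H)\mid 0_H\in A\}$. Its units are the singletons $\{x\}$, $x\in H^\times$. For a strict homomorphism $f$, $\overline{\mathcal{F}}(f)$ is $A\mapsto f(A)$. **Matroids.** A Grassmann-Plücker function of rank $r$ on $E$ with coefficients in a hyperfield $H$ is a function $\varphi:E^r\to H$ that is not identically zero, is alternating ($\varphi(x_{\sigma(1)},\dots,x_{\sigma(r)})=-\varphi(x_1,\dots,x_r)$ for odd permutations $\sigma$, and $\varphi(x_1,\dots,x_r)=0$ if the $x_i$ are not pairwise distinct), and satisfies, for all $x_1,\dots,x_{r+1},y_1,\dots,y_{r-1}\in E$, $$0\in\sum_{k=1}^{r+1}(-1)^k\varphi(x_1,\dots,\hat{x_k},\dots,x_{r+1})\,\varphi(x_k,y_1,\dots,y_{r-1})$$ (hypersum in $H$).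 With coefficients in a fuzzy ring $K$, it is a function $\varphi:E^r\to K^\times\cup\{0\}$ that is not identically zero, is $\varepsilon$-alternating ($\varphi(x_{\sigma(1)},\dots,x_{\sigma(r)})=\varepsilon\varphi(x_1,\dots,x_r)$ for odd $\sigma$, and $\varphi(x_1,\dots,x_r)=0$ if the $x_i$ are not pairwise distinct), and satisfies, for all $x_i,y_j\in E$, $$\sum_{k=1}^{r+1}\varepsilon^k\varphi(x_1,\dots,\hat{x_k},\dots,x_{r+1})\times\varphi(x_k,y_1,\dots,y_{r-1})\in K_0.$$ In both cases two such functions are equivalent if one is obtained from the other by multiplication by a unit, and a rank $r$ matroid on $E$ with the given coefficients is an equivalence class of such functions. *)

(* Defs.v *)
From HB Require Import structures.
From mathcomp Require Import all_boot all_fingroup.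
From mathcomp Require Import boolp classical_sets functions.

Set Implicit Arguments.
Unset Strict Implicit.
Unset Printing Implicit Defensive.

Local Open Scope classical_set_scope.

Record category := Category {
  Ob :> Type;
  Hom : Ob -> Ob -> Type;
  idm : forall X, Hom X X;
  compm : forall X Y Z, Hom Y Z -> Hom X Y -> Hom X Z;
  comp1m : forall X Y (f : Hom X Y), compm (idm Y) f = f;
  compm1 : forall X Y (f : Hom X Y), compm f (idm X) = f;
  compmA : forall W X Y Z (h : Hom Y Z) (g : Hom X Y) (f : Hom W X),
    compm h (compm g f) = compm (compm h g) f }.

Arguments idm {c} X.
Arguments compm {c X Y Z} g f.

Record functor (C D : category) := Functor {
  Fob :> C -> D;
  Fhom : forall X Y : C, Hom X Y -> Hom (Fob X) (Fob Y);
  Fhom1 : forall X : C, Fhom (idm X) = idm (Fob X);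
  FhomM : forall (X Y Z : C) (g : Hom Y Z) (f : Hom X Y),
    Fhom (compm g f) = compm (Fhom g) (Fhom f) }.

Arguments Fhom {C D} F {X Y} f : rename.

Section FunctorComposition.
Variables (C D E : category) (G : functor D E) (F : functor C D).

Let comp_Fhom (X Y : C) (f : Hom X Y) : Hom (G (F X)) (G (F Y)) :=
  Fhom G (Fhom F f).

Let comp_Fhom1 (X : C) : comp_Fhom (idm X) = idm (G (F X)).
Proof. by rewrite /comp_Fhom !Fhom1. Qed.

Let comp_FhomM (X Y Z : C) (g : Hom Y Z) (f : Hom X Y) :
  comp_Fhom (compm g f) = compm (comp_Fhom g) (comp_Fhom f).
Proof. by rewrite /comp_Fhom !FhomM. Qed.

Definition functor_comp : functor C E := Functor comp_Fhom1 comp_FhomM.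

End FunctorComposition.

Definition faithful (C D : category) (F : functor C D) : Prop :=
  forall (X Y : C) (f g : Hom X Y), Fhom F f = Fhom F g -> f = g.

Definition full (C D : category) (F : functor C D) : Prop :=
  forall (X Y : C) (g : Hom (F X) (F Y)), exists f : Hom X Y, Fhom F f = g.

Definition isomorphic (C : category) (X Y : C) : Prop :=
  exists (f : Hom X Y) (g : Hom Y X), compm g f = idm X /\ compm f g = idm Y.

Definition essentially_surjective (C D : category) (F : functor C D) : Prop :=
  forall Y : D, exists X : C, isomorphic (F X) Y.

Section SetOperations.
Variable A : Type.

Definition set_add (add : A -> A -> set A) (X Y : set A) : set A :=
  \bigcup_(x in X) \bigcup_(y in Y) add x y.

Definition set_mul (mul : A -> A -> A) (X Y : set A) : set A :=
  [set mul x y | x in X & y in Y].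

End SetOperations.

Record is_canonical_hypergroup (A : Type) (add : A -> A -> set A)
    (zero : A) (opp : A -> A) : Prop := {
  ch_nonempty : forall a b, add a b !=set0;
  ch_addC : forall a b, add a b = add b a;
  ch_add0 : forall a, add a zero = [set a];
  ch_addN : forall a, add a (opp a) zero;
  ch_oppU : forall a b, add a b zero -> b = opp a;
  ch_addA : forall a b c,
    set_add add (add a b) [set c] = set_add add [set a] (add b c);
  ch_rev : forall a b c, add b c a <-> add a (opp b) c }.

Record is_hyperring (A : Type) (add : A -> A -> set A) (mul : A -> A -> A)
    (zero one : A) (opp : A -> A) : Prop := {
  hr_hypergroup :> is_canonical_hypergroup add zero opp;
  hr_mulA : associative mul;
  hr_mulC : commutative mul;
  hr_mul1 : left_id one mul;
  hr_mulD : forall a b c, mul a @` add b c = add (mul a b) (mul a c);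
  hr_mul0 : forall a, mul a zero = zero }.

(* Given the hyperring axioms, the last two fields say that the nonzero
   elements form a group under [mul]: closure under [mul] follows from the
   existence of inverses, and the neutral element can only be [one]. *)
Record is_hyperfield (A : Type) (add : A -> A -> set A) (mul : A -> A -> A)
    (zero one : A) (opp : A -> A) : Prop := {
  hf_hyperring :> is_hyperring add mul zero one opp;
  hf_one_neq0 : one <> zero;
  hf_inv : forall a, a <> zero -> exists2 b, b <> zero & mul a b = one }.

Record hyperfield := Hyperfield {
  hcar :> Type;
  hadd : hcar -> hcar -> set hcar;
  hmul : hcar -> hcar -> hcar;
  hzero : hcar;
  hone : hcar;
  hopp : hcar -> hcar;
  hyperfieldP : is_hyperfield hadd hmul hzero hone hopp }.

Arguments hadd {h}.
Arguments hmul {h}.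
Arguments hzero {h}.
Arguments hone {h}.
Arguments hopp {h}.

Definition hsadd (H : hyperfield) : set H -> set H -> set H := set_add hadd.
Definition hsmul (H : hyperfield) : set H -> set H -> set H := set_mul hmul.

Definition doubly_distributive (H : hyperfield) : Prop :=
  forall a b c d : H,
    hsmul (hadd a b) (hadd c d) =
    hsadd (hsadd (hadd (hmul a c) (hmul a d)) [set hmul b c]) [set hmul b d].

Record hyperfield_dd := HyperfieldDD {
  dd_hyperfield :> hyperfield;
  hyperfield_ddP : doubly_distributive dd_hyperfield }.

Record strict_hom (H H' : hyperfield) := StrictHom {
  sh_fun :> H -> H';
  sh0 : sh_fun hzero = hzero;
  sh1 : sh_fun hone = hone;
  shM : forall a b, sh_fun (hmul a b) = hmul (sh_fun a) (sh_fun b);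
  shD : forall a b, sh_fun @` hadd a b = hadd (sh_fun a) (sh_fun b) }.

Lemma strict_hom_eq (H H' : hyperfield) (f g : strict_hom H H') :
  (forall x, f x = g x) -> f = g.
Proof.
case: f g => [f f0 f1 fM fD] [g g0 g1 gM gD] /= /funext fg.
by subst g; congr StrictHom; exact: Prop_irrelevance.
Qed.

Section StrictHomCategory.

Definition strict_hom_id (H : hyperfield) : strict_hom H H :=
  @StrictHom H H idfun erefl erefl (fun _ _ => erefl)
    (fun a b => image_id (hadd a b)).

Variables (H1 H2 H3 : hyperfield) (g : strict_hom H2 H3) (f : strict_hom H1 H2).

Let comp0 : g (f hzero) = hzero. Proof. by rewrite !sh0. Qed.
Let comp1 : g (f hone) = hone. Proof. by rewrite !sh1. Qed.
Let compM a b : g (f (hmul a b)) = hmul (g (f a)) (g (f b)).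
Proof. by rewrite !shM. Qed.
Let compD a b : (fun x => g (f x)) @` hadd a b = hadd (g (f a)) (g (f b)).
Proof. by rewrite -!shD -image_comp. Qed.

Definition strict_hom_comp : strict_hom H1 H3 :=
  @StrictHom H1 H3 (fun x => g (f x)) comp0 comp1 compM compD.

End StrictHomCategory.

Definition Hyperfields_dd : category.
Proof.
refine (@Category hyperfield_dd (fun H H' => strict_hom H H')
  (fun H => strict_hom_id H)
  (fun H1 H2 H3 g f => strict_hom_comp g f) _ _ _).
- by move=> X Y f; exact: strict_hom_eq.
- by move=> X Y f; exact: strict_hom_eq.
- by move=> W X Y Z h g f; exact: strict_hom_eq.
Defined.

Definition is_comm_monoid (K : Type) (op : K -> K -> K) (e : K) : Prop :=
  [/\ associative op, commutative op & left_id e op].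

Definition is_mul_unit (K : Type) (mul : K -> K -> K) (one a : K) : Prop :=
  exists b, mul a b = one.

Record is_fuzzy_ring (K : Type) (add mul : K -> K -> K) (zero one eps : K)
    (null : set K) : Prop := {
  fr0_add : is_comm_monoid add zero;
  fr0_mul : is_comm_monoid mul one;
  fr1 : forall a, mul zero a = zero;
  fr2 : forall a b c, is_mul_unit mul one a ->
    mul a (add b c) = add (mul a b) (mul a c);
  fr3 : mul eps eps = one;
  fr4_add : forall a b, null a -> null b -> null (add a b);
  fr4_mul : forall a b, null b -> null (mul a b);
  fr4_zero : null zero;
  fr4_one : ~ null one;
  fr5 : forall a, is_mul_unit mul one a -> (null (add one a) <-> a = eps);
  fr6 : forall a b c d, null (add a b) -> null (add c d) ->
    null (add (mul a c) (mul eps (mul b d)));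
  fr7 : forall a b c d, null (add a (mul b (add c d))) ->
    null (add (add a (mul b c)) (mul b d)) }.

Record fuzzy_ring := FuzzyRing {
  fcar :> Type;
  fadd : fcar -> fcar -> fcar;
  fmul : fcar -> fcar -> fcar;
  fzero : fcar;
  fone : fcar;
  feps : fcar;
  fnull : set fcar;
  fuzzy_ringP : is_fuzzy_ring fadd fmul fzero fone feps fnull }.

Arguments fadd {f}.
Arguments fmul {f}.
Arguments fzero {f}.
Arguments fone {f}.
Arguments feps {f}.
Arguments fnull {f}.

Definition funit (K : fuzzy_ring) : set K := is_mul_unit fmul fone.
Arguments funit {K}.

Lemma fmulA (K : fuzzy_ring) : associative (@fmul K).
Proof. by case: (fr0_mul (fuzzy_ringP K)). Qed.

Lemma fmulC (K : fuzzy_ring) : commutative (@fmul K).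
Proof. by case: (fr0_mul (fuzzy_ringP K)). Qed.

Lemma fmul1 (K : fuzzy_ring) : left_id fone (@fmul K).
Proof. by case: (fr0_mul (fuzzy_ringP K)). Qed.

Lemma funitM (K : fuzzy_ring) (a b : K) : funit a -> funit b -> funit (fmul a b).
Proof.
move=> [a' aa'] [b' bb']; exists (fmul b' a').
by rewrite fmulA -(fmulA a) bb' (fmulC a) fmul1.
Qed.

Record strong_morphism (K L : fuzzy_ring) := StrongMorphism {
  sm_fun :> K -> L;
  sm1 : sm_fun fone = fone;
  sm0 : sm_fun fzero = fzero;
  smM : forall a b, funit a -> sm_fun (fmul a b) = fmul (sm_fun a) (sm_fun b);
  sm_null : forall (n : nat) (a b : 'I_n -> K),
    fnull (\big[fadd/fzero]_(i < n) fmul (a i) (b i)) ->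
    fnull (\big[fadd/fzero]_(i < n) fmul (sm_fun (a i)) (sm_fun (b i))) }.

Lemma strong_morphism_eq (K L : fuzzy_ring) (f g : strong_morphism K L) :
  (forall x, f x = g x) -> f = g.
Proof.
case: f g => [f f1 f0 fM fD] [g g1 g0 gM gD] /= /funext fg.
by subst g; congr StrongMorphism; exact: Prop_irrelevance.
Qed.

Lemma sm_unit (K L : fuzzy_ring) (f : strong_morphism K L) (a : K) :
  funit a -> funit (f a).
Proof. by move=> ua; have [b ab] := ua; exists (f b); rewrite -smM// ab sm1. Qed.

Section StrongMorphismCategory.

Definition strong_morphism_id (K : fuzzy_ring) : strong_morphism K K :=
  @StrongMorphism K K idfun erefl erefl (fun _ _ _ => erefl) (fun _ _ _ h => h).

Variables (K1 K2 K3 : fuzzy_ring).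
Variables (g : strong_morphism K2 K3) (f : strong_morphism K1 K2).

Let comp1 : g (f fone) = fone. Proof. by rewrite !sm1. Qed.
Let comp0 : g (f fzero) = fzero. Proof. by rewrite !sm0. Qed.
Let compM a b : funit a -> g (f (fmul a b)) = fmul (g (f a)) (g (f b)).
Proof. by move=> ua; rewrite !smM//; exact: sm_unit. Qed.
Let comp_null (n : nat) (a b : 'I_n -> K1) :
  fnull (\big[fadd/fzero]_(i < n) fmul (a i) (b i)) ->
  fnull (\big[fadd/fzero]_(i < n) fmul (g (f (a i))) (g (f (b i)))).
Proof. by move=> h; do 2 apply: sm_null. Qed.

Definition strong_morphism_comp : strong_morphism K1 K3 :=
  @StrongMorphism K1 K3 (fun x => g (f x)) comp1 comp0 compM comp_null.

End StrongMorphismCategory.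

Definition FuzzyRings_str : category.
Proof.
refine (@Category fuzzy_ring strong_morphism strong_morphism_id
  strong_morphism_comp _ _ _).
- by move=> X Y f; exact: strong_morphism_eq.
- by move=> X Y f; exact: strong_morphism_eq.
- by move=> W X Y Z h g f; exact: strong_morphism_eq.
Defined.

Definition funits (K : fuzzy_ring) : Type := {a : K | funit a}.

Definition funits_mul (K : fuzzy_ring) (u v : funits K) : funits K :=
  exist _ (fmul (sval u) (sval v)) (funitM (svalP u) (svalP v)).

Record weak_morphism (K L : fuzzy_ring) := WeakMorphism {
  wm_fun :> funits K -> funits L;
  wmM : forall u v, wm_fun (funits_mul u v) = funits_mul (wm_fun u) (wm_fun v);
  wm_null : forall (n : nat) (a : 'I_n -> funits K),
    fnull (\big[fadd/fzero]_(i < n) sval (a i)) ->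
    fnull (\big[fadd/fzero]_(i < n) sval (wm_fun (a i))) }.

Lemma weak_morphism_eq (K L : fuzzy_ring) (f g : weak_morphism K L) :
  (forall x, f x = g x) -> f = g.
Proof.
case: f g => [f fM fD] [g gM gD] /= /funext fg.
by subst g; congr WeakMorphism; exact: Prop_irrelevance.
Qed.

Section WeakMorphismCategory.

Definition weak_morphism_id (K : fuzzy_ring) : weak_morphism K K :=
  @WeakMorphism K K idfun (fun _ _ => erefl) (fun _ _ h => h).

Variables (K1 K2 K3 : fuzzy_ring).
Variables (g : weak_morphism K2 K3) (f : weak_morphism K1 K2).

Let compM u v : g (f (funits_mul u v)) = funits_mul (g (f u)) (g (f v)).
Proof. by rewrite !wmM. Qed.
Let comp_null (n : nat) (a : 'I_n -> funits K1) :
  fnull (\big[fadd/fzero]_(i < n) sval (a i)) ->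
  fnull (\big[fadd/fzero]_(i < n) sval (g (f (a i)))).
Proof. by move=> h; do 2 apply: wm_null. Qed.

Definition weak_morphism_comp : weak_morphism K1 K3 :=
  @WeakMorphism K1 K3 (fun x => g (f x)) compM comp_null.

End WeakMorphismCategory.

Definition FuzzyRings_wk : category.
Proof.
refine (@Category fuzzy_ring weak_morphism weak_morphism_id
  weak_morphism_comp _ _ _).
- by move=> X Y f; exact: weak_morphism_eq.
- by move=> X Y f; exact: weak_morphism_eq.
- by move=> W X Y Z h g f; exact: weak_morphism_eq.
Defined.

Section RestrictToUnits.
Variables (K L : fuzzy_ring) (f : strong_morphism K L).

Definition restrict_units_fun (u : funits K) : funits L :=
  exist _ (f (sval u)) (sm_unit f (svalP u)).

Let restrict_unitsM u v : restrict_units_fun (funits_mul u v) =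
  funits_mul (restrict_units_fun u) (restrict_units_fun v).
Proof. by apply: eq_exist => /=; rewrite smM//; exact: svalP. Qed.

Let restrict_units_null (n : nat) (a : 'I_n -> funits K) :
  fnull (\big[fadd/fzero]_(i < n) sval (a i)) ->
  fnull (\big[fadd/fzero]_(i < n) sval (restrict_units_fun (a i))).
Proof.
move=> h.
under eq_bigr do rewrite /= -[f _]fmul1 -(sm1 f).
apply: sm_null.
by under eq_bigr do rewrite fmul1.
Qed.

Definition restrict_units_hom : weak_morphism K L :=
  @WeakMorphism K L restrict_units_fun restrict_unitsM restrict_units_null.

End RestrictToUnits.

Definition restrict_units : functor FuzzyRings_str FuzzyRings_wk.
Proof.
refine (@Functor FuzzyRings_str FuzzyRings_wk (fun K => K)
  restrict_units_hom _ _).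
- by move=> K; apply: weak_morphism_eq => u; case: u => u pu; exact: eq_exist.
- by move=> X Y Z g f; apply: weak_morphism_eq => u; exact: eq_exist.
Defined.

Definition hypersum (H : hyperfield) (s : seq H) : set H :=
  \big[@hsadd H/[set hzero]]_(x <- s) [set x].

Section HyperfieldTheory.
Variable H : hyperfield.
Implicit Types (a b c x y z : H) (X Y Z : set H) (s t : seq H).

Let HP := hyperfieldP H.

Lemma haddC a b : hadd a b = hadd b a. Proof. exact: (ch_addC HP). Qed.

Lemma hmulC : commutative (@hmul H). Proof. exact: (hr_mulC HP). Qed.

Lemma hmulA : associative (@hmul H). Proof. exact: (hr_mulA HP). Qed.

Lemma hmul1 : left_id hone (@hmul H). Proof. exact: (hr_mul1 HP). Qed.

Lemma hmulr0 a : hmul a hzero = hzero. Proof. exact: (hr_mul0 HP). Qed.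

Lemma hsaddP X Y z :
  hsadd X Y z <-> exists x y, [/\ X x, Y y & hadd x y z].
Proof.
split; first by move=> [x Xx [y Yy xyz]]; exists x, y.
by move=> [x [y [Xx Yy xyz]]]; exists x => //; exists y.
Qed.

Lemma hsadd11 a b : hsadd [set a] [set b] = hadd a b.
Proof. by rewrite /hsadd /set_add !bigcup_set1. Qed.

Lemma hsaddC : commutative (@hsadd H).
Proof.
by move=> X Y; apply/seteqP; split => z /hsaddP [x [y [? ? ?]]];
  apply/hsaddP; exists y, x; rewrite haddC.
Qed.

Lemma hsadd0 : left_id [set hzero] (@hsadd H).
Proof.
move=> X; apply/seteqP; split => z.
  by move=> /hsaddP [x [y [-> Yy]]]; rewrite haddC (ch_add0 HP) => ->.
move=> Xz; apply/hsaddP; exists hzero, z; split=> //.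
by rewrite haddC (ch_add0 HP).
Qed.

Lemma hsaddA : associative (@hsadd H).
Proof.
move=> X Y Z; apply/seteqP; split => w.
  move=> /hsaddP [x [v [Xx /hsaddP [y [z [Yy Zz yzv]]] xvw]]].
  have : set_add hadd [set x] (hadd y z) w by apply/hsaddP; exists x, v.
  rewrite -(ch_addA HP) => /hsaddP [u [_ [xyu -> uzw]]].
  by apply/hsaddP; exists u, z; split => //; apply/hsaddP; exists x, y.
move=> /hsaddP [v [z [/hsaddP [x [y [Xx Yy xyv]]] Zz vzw]]].
have : set_add hadd (hadd x y) [set z] w by apply/hsaddP; exists v, z.
rewrite (ch_addA HP) => /hsaddP [_ [u [-> yzu xuw]]].
by apply/hsaddP; exists x, u; split => //; apply/hsaddP; exists y, z.
Qed.

HB.instance Definition _ :=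
  Monoid.isComLaw.Build (set H) [set hzero] (@hsadd H) hsaddA hsaddC hsadd0.

Lemma hsmulP X Y z :
  hsmul X Y z <-> exists x y, [/\ X x, Y y & z = hmul x y].
Proof.
split; first by move=> [x Xx [y Yy <-]]; exists x, y.
by move=> [x [y [Xx Yy ->]]]; exists x => //; exists y.
Qed.

Lemma hsmulC : commutative (@hsmul H).
Proof.
by move=> X Y; apply/seteqP; split => z /hsmulP [x [y [? ? ->]]];
  apply/hsmulP; exists y, x; rewrite hmulC.
Qed.

Lemma hsmulA : associative (@hsmul H).
Proof.
move=> X Y Z; apply/seteqP; split => w /hsmulP.
  move=> [x [_ [Xx /hsmulP [y [z [Yy Zz ->]]] ->]]].
  apply/hsmulP; exists (hmul x y), z; split => //; last by rewrite hmulA.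
  by apply/hsmulP; exists x, y.
move=> [_ [z [/hsmulP [x [y [Xx Yy ->]]] Zz ->]]].
apply/hsmulP; exists x, (hmul y z); split => //; last by rewrite hmulA.
by apply/hsmulP; exists y, z.
Qed.

Lemma hsmul11 a b : hsmul [set a] [set b] = [set hmul a b].
Proof.
apply/seteqP; split => z; first by move=> /hsmulP [_ [_ [-> -> ->]]].
by move=> ->; apply/hsmulP; exists a, b.
Qed.

Lemma hsmul1 : left_id [set hone] (@hsmul H).
Proof.
move=> X; apply/seteqP; split => z.
  by move=> /hsmulP [x [y [-> Yy]]]; rewrite hmul1 => ->.
by move=> Xz; apply/hsmulP; exists hone, z; rewrite hmul1.
Qed.

Lemma hsmul0 X : X !=set0 -> hsmul [set hzero] X = [set hzero].
Proof.
move=> [a Xa]; apply/seteqP; split => z.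
  by move=> /hsmulP [x [y [-> Yy ->]]]; rewrite /= hmulC hmulr0.
by move=> ->; apply/hsmulP; exists hzero, a; rewrite hmulC hmulr0.
Qed.

Lemma hsmulDr a X Y :
  hsmul [set a] (hsadd X Y) = hsadd (hsmul [set a] X) (hsmul [set a] Y).
Proof.
apply/seteqP; split => w.
  move=> /hsmulP [_ [z [-> /hsaddP [x [y [Xx Yy xyz]]] ->]]].
  apply/hsaddP; exists (hmul a x), (hmul a y); split.
  - by apply/hsmulP; exists a, x.
  - by apply/hsmulP; exists a, y.
  - by rewrite -(hr_mulD HP); exists z.
move=> /hsaddP [_ [_ [/hsmulP [_ [x [-> Xx ->]]] /hsmulP [_ [y [-> Yy ->]]]]]].
rewrite -(hr_mulD HP) => -[z xyz <-].
by apply/hsmulP; exists a, z; split => //; apply/hsaddP; exists x, y.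
Qed.

Lemma hmulrN a b : hmul a (hopp b) = hopp (hmul a b).
Proof.
apply: (ch_oppU HP); rewrite -(hr_mulD HP).
by exists hzero; [exact: (ch_addN HP)|rewrite hmulr0].
Qed.

Lemma hoppK a : hopp (hopp a) = a.
Proof.
by apply/esym; apply: (ch_oppU HP); rewrite haddC; exact: (ch_addN HP).
Qed.

Lemma hmulNN a b : hmul (hopp a) (hopp b) = hmul a b.
Proof. by rewrite hmulrN hmulC hmulrN hoppK hmulC. Qed.

Lemma hsmul1_unit X Y : Y !=set0 -> hsmul X Y = [set hone] ->
  exists2 x, x <> hzero & X = [set x].
Proof.
move=> [y Yy] XY.
have X_inv x : X x -> hmul x y = hone.
  by move=> Xx; suff : [set hone] (hmul x y) by []; rewrite -XY;
     apply/hsmulP; exists x, y.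
have [x [y' [Xx _ _]]] : exists x y, [/\ X x, Y y & hone = hmul x y].
  by apply/hsmulP; rewrite XY.
exists x.
  by move=> x0; apply: (hf_one_neq0 HP); rewrite -(X_inv x Xx) x0 hmulC hmulr0.
apply/seteqP; split => [z Xz|_ ->//] /=.
by rewrite -[z]hmul1 -(X_inv x Xx) -hmulA (hmulC y) (X_inv z Xz) hmulC hmul1.
Qed.

Lemma hypersum_cons a s : hypersum (a :: s) = hsadd [set a] (hypersum s).
Proof. by rewrite /hypersum big_cons. Qed.

Lemma hypersum_nonempty s : hypersum s !=set0.
Proof.
elim: s => [|a s [b sb]]; first by rewrite /hypersum big_nil; exists hzero.
have [c abc] := ch_nonempty HP a b.
by exists c; rewrite hypersum_cons; apply/hsaddP; exists a, b.
Qed.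

Lemma hypersum_cat s t : hypersum (s ++ t) = hsadd (hypersum s) (hypersum t).
Proof. by rewrite /hypersum big_cat. Qed.

End HyperfieldTheory.

Section DoublyDistributiveTheory.
Variable H : hyperfield_dd.
Implicit Types (a b c d x y z : H) (X Y Z : set H) (s t : seq H).

Let hsmul_bigcup X Y w :
  hsmul X Y w <-> exists y, Y y /\ hsmul X [set y] w.
Proof.
split.
  move=> /hsmulP [x [y [Xx Yy ->]]]; exists y; split => //.
  by apply/hsmulP; exists x, y.
move=> [y [Yy /hsmulP [x [_ [Xx -> ->]]]]].
by apply/hsmulP; exists x, y.
Qed.

Let hsmul_sum2 s c d :
  hsmul (hypersum s) (hadd c d) =
  hsadd (hsmul (hypersum s) [set c]) (hsmul (hypersum s) [set d]).
Proof.
elim: s => [|a s IHs].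
  rewrite /hypersum big_nil !hsmul0 ?hsadd0//; first by exists d.
  - by exists c.
  - exact: (ch_nonempty (hyperfieldP H)).
set S := hypersum s in IHs *.
have step z : hsmul (hadd a z) (hadd c d) =
    hsadd (hadd (hmul a c) (hmul a d)) (hsmul [set z] (hadd c d)).
  rewrite hyperfield_ddP -hsaddA; congr hsadd.
  by rewrite -!hsadd11 hsmulDr !hsmul11.
have -> : hsmul (hypersum (a :: s)) (hadd c d) =
    hsadd (hadd (hmul a c) (hmul a d)) (hsmul S (hadd c d)).
  rewrite hypersum_cons -/S; apply/seteqP; split => w.
    move=> /hsmulP [x [y [/hsaddP [_ [z [-> Sz azx]]] cdy ->]]].
    have : hsmul (hadd a z) (hadd c d) (hmul x y) by apply/hsmulP; exists x, y.
    rewrite step => /hsaddP [u [v [acu zv uvw]]].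
    apply/hsaddP; exists u, v; split => //.
    case/hsmulP: zv => [_ [y' [-> cdy' ->]]].
    by apply/hsmulP; exists z, y'.
  move=> /hsaddP [u [v [acu /hsmulP [z [y [Sz cdy ->]]] uvw]]].
  have : hsmul (hadd a z) (hadd c d) w.
    rewrite step; apply/hsaddP; exists u, (hmul z y); split => //.
    by apply/hsmulP; exists z, y.
  move=> /hsmulP [x [y' [azx cdy' ->]]].
  apply/hsmulP; exists x, y'; split => //.
  by apply/hsaddP; exists a, z.
rewrite IHs hypersum_cons -/S !(hsmulC _ [set _]) !hsmulDr !hsmul11.
by rewrite (hmulC c) (hmulC d) -hsadd11 Monoid.mulmACA.
Qed.

Lemma hsmul_hypersum s t :
  hsmul (hypersum s) (hypersum t) =
  hypersum [seq hmul x y | y <- t, x <- s].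
Proof.
elim: t => [|d t IHt].
  rewrite /hypersum big_nil hsmulC hsmul0 ?big_nil//.
  exact: hypersum_nonempty.
rewrite allpairs_cons hypersum_cat -IHt.
have -> : hypersum [seq hmul x d | x <- s] = hsmul (hypersum s) [set d].
  rewrite hsmulC; elim: (s) => [|a s' IHs].
    by rewrite /hypersum !big_nil hsmul11 hmulr0.
  by rewrite /= !hypersum_cons IHs hsmulDr hsmul11 hmulC.
rewrite hypersum_cons; apply/seteqP; split => w.
  move=> /hsmul_bigcup [y [/hsaddP [_ [z [-> tz dzy]]] syw]].
  have : hsmul (hypersum s) (hadd d z) w by apply/hsmul_bigcup; exists y.
  rewrite hsmul_sum2 => /hsaddP [u [v [su sv uvw]]].
  apply/hsaddP; exists u, v; split => //.
  by apply/hsmul_bigcup; exists z.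
move=> /hsaddP [u [v [su /hsmul_bigcup [z [tz szv]] uvw]]].
have : hsmul (hypersum s) (hadd d z) w.
  by rewrite hsmul_sum2; apply/hsaddP; exists u, v.
move=> /hsmul_bigcup [y [dzy syw]].
apply/hsmul_bigcup; exists y; split => //.
by apply/hsaddP; exists d, z.
Qed.

End DoublyDistributiveTheory.

Definition is_hypersum (H : hyperfield) : set (set H) :=
  [set A | exists2 s : seq H, (0 < size s)%N & A = hypersum s].

Definition Fbar_car (H : hyperfield) : Type := {A : set H | is_hypersum A}.

Section FbarRing.
Variable H : hyperfield_dd.

Lemma is_hypersum_add (A B : set H) :
  is_hypersum A -> is_hypersum B -> is_hypersum (hsadd A B).
Proof.
move=> [s s0 ->] [t t0 ->]; exists (s ++ t); last by rewrite hypersum_cat.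
by rewrite size_cat ltn_addr.
Qed.

Lemma is_hypersum_mul (A B : set H) :
  is_hypersum A -> is_hypersum B -> is_hypersum (hsmul A B).
Proof.
move=> [s s0 ->] [t t0 ->]; rewrite hsmul_hypersum.
by eexists; last reflexivity; rewrite size_allpairs muln_gt0 t0.
Qed.

Lemma is_hypersum_set1 (x : H) : is_hypersum [set x].
Proof. by exists [:: x] => //; rewrite /hypersum big_seq1. Qed.

Lemma is_hypersum_nonempty (A : set H) : is_hypersum A -> A !=set0.
Proof. by move=> [s _ ->]; exact: hypersum_nonempty. Qed.

Definition Fbar_add (A B : Fbar_car H) : Fbar_car H :=
  exist _ (hsadd (sval A) (sval B)) (is_hypersum_add (svalP A) (svalP B)).

Definition Fbar_mul (A B : Fbar_car H) : Fbar_car H :=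
  exist _ (hsmul (sval A) (sval B)) (is_hypersum_mul (svalP A) (svalP B)).

Definition Fbar_set1 (x : H) : Fbar_car H := exist _ [set x] (is_hypersum_set1 x).

Definition Fbar_null : set (Fbar_car H) := [set A | sval A hzero].

Lemma Fbar_eq (A B : Fbar_car H) : sval A = sval B -> A = B.
Proof. by case: A B => [A pA] [B pB] /= AB; exact: eq_exist. Qed.

Lemma Fbar_unitE (A : Fbar_car H) : is_mul_unit Fbar_mul (Fbar_set1 hone) A <->
  exists2 x, x <> hzero & A = Fbar_set1 x.
Proof.
split=> [[B /(congr1 sval) /= AB]|[x x0 ->]].
  have [x x0 Ax] := hsmul1_unit (is_hypersum_nonempty (svalP B)) AB.
  by exists x => //; exact: Fbar_eq.
have [y y0 xy] := hf_inv (hyperfieldP H) x0.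
by exists (Fbar_set1 y); apply: Fbar_eq; rewrite /= hsmul11 xy.
Qed.

Lemma Fbar_is_fuzzy_ring :
  is_fuzzy_ring Fbar_add Fbar_mul (Fbar_set1 hzero) (Fbar_set1 hone)
    (Fbar_set1 (hopp hone)) Fbar_null.
Proof.
have HP := hyperfieldP H.
split.
- split.
  + by move=> A B C; apply: Fbar_eq; exact: hsaddA.
  + by move=> A B; apply: Fbar_eq; exact: hsaddC.
  + by move=> A; apply: Fbar_eq; exact: hsadd0.
- split.
  + by move=> A B C; apply: Fbar_eq; exact: hsmulA.
  + by move=> A B; apply: Fbar_eq; exact: hsmulC.
  + by move=> A; apply: Fbar_eq; exact: hsmul1.
- move=> A; apply: Fbar_eq; apply: hsmul0.
  exact: is_hypersum_nonempty (svalP A).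
- move=> A B C /Fbar_unitE [x _ ->]; apply: Fbar_eq; exact: hsmulDr.
- by apply: Fbar_eq; rewrite /= hsmul11 hmulNN hmul1.
- move=> A B A0 B0; apply/hsaddP; exists hzero, hzero; split => //.
  by rewrite (ch_add0 HP).
- move=> A B B0; have [a Aa] := is_hypersum_nonempty (svalP A).
  by apply/hsmulP; exists a, hzero; rewrite hmulr0.
- by [].
- by move=> /esym; exact: (hf_one_neq0 HP).
- move=> A /Fbar_unitE [x _ ->]; split => [|->].
    by rewrite /Fbar_null /= hsadd11 => /(ch_oppU HP) ->.
  by rewrite /Fbar_null /= hsadd11; exact: (ch_addN HP).
- move=> A B C D /hsaddP [a [b [Aa Bb /(ch_oppU HP) ba]]].
  move=> /hsaddP [c [d [Cc Dd /(ch_oppU HP) dc]]].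
  apply/hsaddP; exists (hmul a c), (hopp (hmul a c)); split.
  + by apply/hsmulP; exists a, c.
  + apply/hsmulP; exists (hopp hone), (hmul b d); split => //.
      by apply/hsmulP; exists b, d.
    by rewrite ba dc hmulNN (hmulC (hopp _)) hmulrN (hmulC _ hone) hmul1.
  + exact: (ch_addN HP).
- move=> A B C D /hsaddP [a [w [Aa /hsmulP [b [v [Bb cdv ->]]] a0]]].
  rewrite /Fbar_null /= -hsaddA; apply/hsaddP; exists a, (hmul b v); split => //.
  have : hsmul [set b] (hsadd (sval C) (sval D)) (hmul b v).
    by apply/hsmulP; exists b, v.
  rewrite hsmulDr => /hsaddP [x [y [/hsmulP [_ [c [-> Cc ->]]]]]].
  move=> /hsmulP [_ [d [-> Dd ->]]] xy.
  apply/hsaddP; exists (hmul b c), (hmul b d); split => //.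
    by apply/hsmulP; exists b, c.
  by apply/hsmulP; exists b, d.
Qed.

Definition Fbar_ring : fuzzy_ring := FuzzyRing Fbar_is_fuzzy_ring.

End FbarRing.

Section FbarHom.
Variables (H H' : hyperfield_dd) (f : strict_hom H H').

Lemma image_hsadd (A B : set H) : f @` hsadd A B = hsadd (f @` A) (f @` B).
Proof.
apply/seteqP; split => [_ [z /hsaddP [x [y [Ax By xyz]]] <-]|w].
  apply/hsaddP; exists (f x), (f y); split; [by exists x|by exists y|].
  by rewrite -shD; exists z.
move=> /hsaddP [_ [_ [[x Ax <-] [y By <-]]]]; rewrite -shD => -[z xyz <-].
by exists z => //; apply/hsaddP; exists x, y.
Qed.

Lemma image_hsmul (A B : set H) : f @` hsmul A B = hsmul (f @` A) (f @` B).
Proof.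
apply/seteqP; split => [_ [z /hsmulP [x [y [Ax By ->]]] <-]|w].
  by apply/hsmulP; exists (f x), (f y); split; [exists x|exists y|rewrite shM].
move=> /hsmulP [_ [_ [[x Ax <-] [y By <-]] ->]].
by exists (hmul x y); [apply/hsmulP; exists x, y|rewrite shM].
Qed.

Lemma image_is_hypersum (A : set H) : is_hypersum A -> is_hypersum (f @` A).
Proof.
move=> [s s0 ->]; exists (map f s); first by rewrite size_map.
elim: s {s0} => [|a s IHs]; first by rewrite /hypersum !big_nil image_set1 sh0.
by rewrite /= !hypersum_cons image_hsadd image_set1 IHs.
Qed.

Definition Fbar_fun (A : Fbar_ring H) : Fbar_ring H' :=
  exist _ (f @` sval A) (image_is_hypersum (svalP A)).

Let Fbar_fun1 : Fbar_fun fone = fone.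
Proof. by apply: Fbar_eq; rewrite /= image_set1 sh1. Qed.

Let Fbar_fun0 : Fbar_fun fzero = fzero.
Proof. by apply: Fbar_eq; rewrite /= image_set1 sh0. Qed.

Let Fbar_funM A B : Fbar_fun (fmul A B) = fmul (Fbar_fun A) (Fbar_fun B).
Proof. by apply: Fbar_eq; rewrite /= image_hsmul. Qed.

Let Fbar_funD A B : Fbar_fun (fadd A B) = fadd (Fbar_fun A) (Fbar_fun B).
Proof. by apply: Fbar_eq; rewrite /= image_hsadd. Qed.

Let Fbar_fun_null (n : nat) (a b : 'I_n -> Fbar_ring H) :
  fnull (\big[fadd/fzero]_(i < n) fmul (a i) (b i)) ->
  fnull (\big[fadd/fzero]_(i < n) fmul (Fbar_fun (a i)) (Fbar_fun (b i))).
Proof.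
under [in X in _ -> X]eq_bigr do rewrite -Fbar_funM.
rewrite -(big_morph _ Fbar_funD Fbar_fun0) => h.
by exists hzero => //; rewrite sh0.
Qed.

Definition Fbar_hom : strong_morphism (Fbar_ring H) (Fbar_ring H') :=
  @StrongMorphism (Fbar_ring H) (Fbar_ring H') Fbar_fun Fbar_fun1 Fbar_fun0
    (fun A B _ => Fbar_funM A B) Fbar_fun_null.

End FbarHom.

Definition Fbar : functor Hyperfields_dd FuzzyRings_str.
Proof.
refine (@Functor Hyperfields_dd FuzzyRings_str Fbar_ring Fbar_hom _ _).
- move=> H; apply: strong_morphism_eq => A; apply: Fbar_eq; exact: image_id.
- move=> X Y Z g f; apply: strong_morphism_eq => A; apply: Fbar_eq => /=.
  by rewrite image_comp.
Defined.

Section TupleOperations.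
Variables (E : finType) (r : nat).

Definition perm_tuple (s : 'S_r) (x : r.-tuple E) : r.-tuple E :=
  [tuple tnth x (s i) | i < r].

Definition omit_tuple (k : 'I_r.+1) (x : r.+1.-tuple E) : r.-tuple E :=
  [tuple tnth x (lift k i) | i < r].

(* [z :: y] has size [r.-1.+1], which is only propositionally equal to [r]
   (for [0 < r]); the default value [z] of [nth] is never reached then. *)
Definition cons_tuple (z : E) (y : r.-1.-tuple E) : r.-tuple E :=
  [tuple nth z (z :: y) i | i < r].

End TupleOperations.

Section HyperfieldMatroid.
Variables (H : hyperfield) (E : finType) (r : nat).

Record hGP (phi : r.-tuple E -> H) : Prop := {
  hGP_neq0 : exists x, phi x <> hzero;
  hGP_odd : forall (s : 'S_r) x, odd_perm s ->
    phi (perm_tuple s x) = hopp (phi x);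
  hGP_alt : forall x : r.-tuple E, ~~ uniq x -> phi x = hzero;
  (* the [k]-th term for [k : 'I_r.+1] is the [k.+1]-st one when counting from
     one, hence the exponent *)
  hGP_rel : forall (x : r.+1.-tuple E) (y : r.-1.-tuple E),
    (\big[@hsadd H/[set hzero]]_(k < r.+1)
       [set hmul (iter k.+1 (hmul (hopp hone)) hone)
              (hmul (phi (omit_tuple k x)) (phi (cons_tuple (tnth x k) y)))])
      hzero }.

Definition hGP_equiv (phi psi : r.-tuple E -> H) : Prop :=
  exists2 u : H, u <> hzero & psi = fun x => hmul u (phi x).

Definition hmatroid : set (set (r.-tuple E -> H)) :=
  [set M | exists2 phi, hGP phi & M = [set psi | hGP psi /\ hGP_equiv phi psi]].

End HyperfieldMatroid.

Section FuzzyMatroid.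
Variables (K : fuzzy_ring) (E : finType) (r : nat).

Record fGP (phi : r.-tuple E -> K) : Prop := {
  fGP_unit : forall x, funit (phi x) \/ phi x = fzero;
  fGP_neq0 : exists x, phi x <> fzero;
  fGP_odd : forall (s : 'S_r) x, odd_perm s ->
    phi (perm_tuple s x) = fmul feps (phi x);
  fGP_alt : forall x : r.-tuple E, ~~ uniq x -> phi x = fzero;
  fGP_rel : forall (x : r.+1.-tuple E) (y : r.-1.-tuple E),
    fnull (\big[fadd/fzero]_(k < r.+1)
       fmul (iter k.+1 (fmul feps) fone)
         (fmul (phi (omit_tuple k x)) (phi (cons_tuple (tnth x k) y)))) }.

Definition fGP_equiv (phi psi : r.-tuple E -> K) : Prop :=
  exists2 u : K, funit u & psi = fun x => fmul u (phi x).

Definition fmatroid : set (set (r.-tuple E -> K)) :=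
  [set M | exists2 phi, fGP phi & M = [set psi | fGP psi /\ fGP_equiv phi psi]].

End FuzzyMatroid.

(* Main.v *)
Require Import Defs.
From mathcomp Require Import all_boot.
From mathcomp Require Import boolp classical_sets functions.

(** Faithfulness holds because the singleton [{x}] determines [x] and the
    functor sends [{x}] to [{f x}]; every nonzero [x] gives a unit [{x}], so the
    values of [f] are already visible on units.

    Fullness fails because strong and weak morphisms only have to preserve
    nullity of sums, which tolerates an inclusion [f (a + b) <= f a + f b],
    whereas a strict homomorphism needs an equality.  The identity of [{0, 1}]
    from the field with two elements, where [1 + 1 = {0}], to the Krasner
    hyperfield, where [1 + 1 = {0, 1}], is such a map
    ([F2_to_Krasner]), and there is no strict homomorphism at all between these
    two ([no_strict_hom_F2_Krasner]).

    Essential surjectivity fails because nullity of a sum in a hyperfield can be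
    tested through intermediate sums.  If the unit group is trivial, either
    [1 + 1] contains [1] and then [1 + 1 + 1] is null, or [1 + 1 = {0}] and then
    a sum of five ones is the same as a sum of three.  So if five ones have a
    null sum in some [Fbar_ring H] with one unit, then so do three, unlike in the
    semiring of natural numbers with null set
    [N \ {1, 3}], which is a fuzzy ring ([nat_is_fuzzy_ring]).  The argument
    mentions only units and null sums of units, hence excludes a weak
    isomorphism, and a fortiori a strong one.

    For matroids, [x |-> {x}] is an injection of [H] onto the units of
    [Fbar_ring H] together with zero; it is multiplicative, and turns hypersums
    containing zero into null sums.  Thus the axioms of Grassmann-Plucker
    functions and their equivalence are translated literally, and direct image
    under the resulting injection of function sets is a bijection between
    equivalence classes. *)

Set Implicit Arguments.
Unset Strict Implicit.
Unset Printing Implicit Defensive.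

Local Open Scope classical_set_scope.

(** * Singletons in the fuzzy ring of a hyperfield *)

Lemma Fbar_set1_inj (H : hyperfield_dd) : injective (@Fbar_set1 H).
Proof.
move=> x y /(congr1 sval) /= xy.
by have : [set x] x by []; rewrite xy.
Qed.

Lemma Fbar_hom_set1 (H H' : hyperfield_dd) (f : strict_hom H H') (x : H) :
  Fbar_hom f (Fbar_set1 x) = Fbar_set1 (f x).
Proof. by apply: Fbar_eq; rewrite /= image_set1. Qed.

Lemma Fbar_set1_unit (H : hyperfield_dd) (x : H) :
  x <> hzero -> funit (Fbar_set1 x : Fbar_ring H).
Proof. by move=> x0; apply/Fbar_unitE; exists x. Qed.

Lemma Fbar_set1M (H : hyperfield_dd) (x y : H) :
  fmul (Fbar_set1 x : Fbar_ring H) (Fbar_set1 y) = Fbar_set1 (hmul x y).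
Proof. by apply: Fbar_eq; rewrite /= hsmul11. Qed.

Lemma Fbar_sumE (H : hyperfield_dd) (I : Type) (s : seq I)
    (F : I -> Fbar_ring H) :
  sval (\big[fadd/fzero]_(i <- s) F i) =
  \big[@hsadd H/[set hzero]]_(i <- s) sval (F i).
Proof. exact: (big_morph (fun A : Fbar_ring H => sval A)). Qed.

(** * Faithfulness, and composition of functors *)

(** A nonzero [x] is recovered from the unit [{x}], and zero is preserved by
    every strict homomorphism, so nothing is lost by restricting to units. *)
Lemma faithful_restrict_Fbar : faithful (functor_comp restrict_units Fbar).
Proof.
move=> H H' f g /= fg; apply: strict_hom_eq => x.
have [->|x0] := pselect (x = hzero); first by rewrite !sh0.
apply: Fbar_set1_inj; rewrite -!Fbar_hom_set1.
exact: (congr1 (fun h : weak_morphism (Fbar_ring H) (Fbar_ring H') =>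
  sval (h (exist _ _ (Fbar_set1_unit x0)))) fg).
Qed.

Lemma faithful_compr (C D E : category) (G : functor D E) (F : functor C D) :
  faithful (functor_comp G F) -> faithful F.
Proof. by move=> GFf X Y f g fg; apply: GFf; rewrite /= fg. Qed.

Lemma isomorphic_functor (C D : category) (F : functor C D) (X Y : C) :
  isomorphic X Y -> isomorphic (F X) (F Y).
Proof.
by move=> [f [g [gf fg]]]; exists (Fhom F f), (Fhom F g);
  rewrite -!FhomM gf fg !Fhom1.
Qed.

Lemma isomorphic_trans (C : category) (X Y Z : C) :
  isomorphic X Y -> isomorphic Y Z -> isomorphic X Z.
Proof.
move=> [f [g [gf fg]]] [h [k [kh hk]]]; exists (compm h f), (compm g k).
split; first by rewrite compmA -(compmA g) kh compm1.
by rewrite compmA -(compmA h) fg compm1.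
Qed.

(** Restriction to units is surjective on objects, so this carries the failure
    of essential surjectivity from weak morphisms back to strong ones. *)
Lemma essentially_surjective_comp (C D E : category) (G : functor D E)
    (F : functor C D) :
  essentially_surjective G -> essentially_surjective F ->
  essentially_surjective (functor_comp G F).
Proof.
move=> Gs Fs Z; have [Y GYZ] := Gs Z; have [X FXY] := Fs Y.
by exists X; apply: isomorphic_trans GYZ; exact: isomorphic_functor FXY.
Qed.

Lemma essentially_surjective_restrict_units :
  essentially_surjective restrict_units.
Proof. by move=> K; exists K, (idm _), (idm _); rewrite comp1m. Qed.

(** * The two hyperfields with one unit, and failure of fullness *)

(** With [1] as the only unit, [-1 = 1], so [1 + 1] contains [0] and the only
    freedom is whether it contains [1]; the parameter [d] makes that choice:
    the field with two elements for [false], the Krasner hyperfield for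
    [true].  Treating both at once reduces all the axioms to one truth-table
    computation. *)
Section BoolHyperfield.
Variable d : bool.

Definition bool_add (a b : bool) : set bool :=
  [set c | (d && a && b) || (c == a (+) b)].

Let set1_bool (a : bool) : [set a] = [set x | x == a].
Proof. by apply/seteqP; split => x /= /eqP. Qed.

(* Membership in a sum or a product of subsets becomes a boolean
   expression, so that equalities of such sets are decided by cases. *)
Let set_add_bool (P Q : bool -> bool) :
  set_add bool_add [set x | P x] [set x | Q x] =
  [set z | has (fun x => has (fun y => [&& P x, Q y &
    (d && x && y) || (z == x (+) y)]) [:: true; false]) [:: true; false]].
Proof.
apply/seteqP; split=> z.
  move=> [x /= Px [y /= Qy]]; rewrite /bool_add /=.
  by case: x y Px Qy => [] [] -> -> ->; rewrite ?orbT.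
move=> /hasP [x _ /hasP [y _ /and3P [Px Qy xyz]]].
by exists x => //; exists y.
Qed.

Let set_mul_bool (P Q : bool -> bool) :
  set_mul andb [set x | P x] [set x | Q x] =
  [set z | has (fun x => has (fun y => [&& P x, Q y & z == x && y])
     [:: true; false]) [:: true; false]].
Proof.
apply/seteqP; split=> z.
  by move=> [x /= Px [y /= Qy <-]]; case: x y Px Qy => [] [] -> ->; rewrite ?orbT.
move=> /hasP [x _ /hasP [y _ /and3P [Px Qy /eqP ->]]].
by exists x => //; exists y.
Qed.

Let eq_set_bool (P Q : bool -> bool) : P =1 Q -> [set x | P x] = [set x | Q x].
Proof. by move=> PQ; congr mkset; apply/funext => x; rewrite PQ. Qed.

Lemma bool_is_hyperfield : is_hyperfield bool_add andb false true id.
Proof.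
split; [split; [split|..] |..] => //.
- by move=> a b; exists (a (+) b); rewrite /bool_add /= eqxx orbT.
- by move=> a b; apply: eq_set_bool; case: d a b => [] [] [].
- by move=> a; rewrite set1_bool; apply: eq_set_bool; case: d a => [] [] [].
- by move=> a; rewrite /bool_add /=; case: d a => [] [].
- by move=> a b; rewrite /bool_add /=; case: d a b => [] [] [].
- move=> a b c; rewrite !set1_bool !set_add_bool; apply: eq_set_bool.
  by case: d a b c => [] [] [] [] [].
- by move=> a b c; rewrite /bool_add /=; case: d a b c => [] [] [] [].
- exact: andbA.
- exact: andbC.
- move=> a b c.
  have -> : andb a @` bool_add b c = set_mul andb [set a] (bool_add b c).
    apply/seteqP; split => [_ [x bcx <-]|_ [_ -> [x bcx <-]]].
      by exists a => //; exists x.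
    by exists x.
  rewrite set1_bool set_mul_bool; apply: eq_set_bool.
  by case: d a b c => [] [] [] [] [].
- by move=> a; rewrite andbF.
- by case=> // _; exists true.
Qed.

Lemma bool_doubly_distributive :
  doubly_distributive (Hyperfield bool_is_hyperfield).
Proof.
move=> a b c e; rewrite /hsmul /hsadd /= set_mul_bool !set1_bool !set_add_bool.
by apply: eq_set_bool; case: d a b c e => [] [] [] [] [] [].
Qed.

Definition bool_hyperfield : hyperfield_dd :=
  HyperfieldDD bool_doubly_distributive.

End BoolHyperfield.

(** Strictness would give [{0} = f (1 + 1) = f 1 + f 1 = {0, 1}]. *)
Lemma no_strict_hom_F2_Krasner :
  strict_hom (bool_hyperfield false) (bool_hyperfield true) -> False.
Proof.
move=> f; have := shD f true true.
rewrite (sh1 f : f true = true) => /seteqP [_ /(_ true isT)] [x].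
by rewrite /hadd /= /bool_add /= => /eqP ->; rewrite (sh0 f : f false = false).
Qed.

Lemma F2_hypersum_set1 (A : set bool) :
  @is_hypersum (bool_hyperfield false) A -> exists x : bool, A = [set x].
Proof.
move=> [s _ ->]; elim: s => [|a s [x IHs]].
  by exists false; rewrite /hypersum big_nil.
exists (a (+) x); rewrite hypersum_cons IHs hsadd11.
by apply/seteqP; split => y /= /eqP.
Qed.

Lemma F2_hypersum_Krasner (A : set bool) :
  @is_hypersum (bool_hyperfield false) A ->
  @is_hypersum (bool_hyperfield true) A.
Proof.
move=> /F2_hypersum_set1 [x ->].
exact: (is_hypersum_set1 (x : bool_hyperfield true)).
Qed.

Definition F2_to_Krasner_fun (A : Fbar_ring (bool_hyperfield false)) :
    Fbar_ring (bool_hyperfield true) :=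
  exist _ (sval A) (F2_hypersum_Krasner (svalP A)).

(** Hyperaddition in the Krasner hyperfield contains addition modulo two and
    the products agree, so a sum only grows when it is computed on the Krasner
    side; if it contained zero before, it still does. *)
Lemma F2_to_Krasner_null (n : nat)
    (a b : 'I_n -> Fbar_ring (bool_hyperfield false)) :
  fnull (\big[fadd/fzero]_(i < n) fmul (a i) (b i)) ->
  fnull (\big[fadd/fzero]_(i < n)
    fmul (F2_to_Krasner_fun (a i)) (F2_to_Krasner_fun (b i))).
Proof.
suff sub : sval (\big[fadd/fzero]_(i < n) fmul (a i) (b i)) `<=`
    sval (\big[fadd/fzero]_(i < n)
      fmul (F2_to_Krasner_fun (a i)) (F2_to_Krasner_fun (b i))) by exact: sub.
elim/big_ind2: _ => [//| |i _ x //].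
move=> A A' B B' AA' BB' c [x Ax [y By xy]].
exists x; first exact: AA'.
exists y; first exact: BB'.
by move: xy; rewrite /hadd /= /bool_add /= => ->; rewrite orbT.
Qed.

Definition F2_to_Krasner :
    strong_morphism (Fbar_ring (bool_hyperfield false))
      (Fbar_ring (bool_hyperfield true)).
Proof.
refine (@StrongMorphism _ _ F2_to_Krasner_fun _ _ _ F2_to_Krasner_null).
- exact: Fbar_eq.
- exact: Fbar_eq.
- by move=> A B _; exact: Fbar_eq.
Defined.

Lemma not_full_of_no_hom (C D : category) (F : functor C D) (X Y : C) :
  (Hom X Y -> False) -> Hom (F X) (F Y) -> ~ full F.
Proof. by move=> noXY g Ff; have [f _] := Ff X Y g; exact: noXY f. Qed.

(** * A fuzzy ring outside the essential image *)

(** The essential feature is that three ones are not null while two and five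
    ones are; adding the remaining numbers makes it an ideal satisfying the
    fuzzy ring axioms. *)
Definition nat_null : set nat := [set n | (n != 1) && (n != 3)].

Lemma nat_unit (a : nat) : is_mul_unit muln 1 a -> a = 1.
Proof. by move=> [b /eqP]; rewrite muln_eq1 => /andP [/eqP]. Qed.

(** Every number that is at least four is null, so each axiom about the null set
    is decided by telling apart 0, 1, 2, 3 and the numbers from four on. *)
Lemma nat_is_fuzzy_ring : is_fuzzy_ring addn muln 0 1 1 nat_null.
Proof.
split.
- by split; [exact: addnA|exact: addnC|exact: add0n].
- by split; [exact: mulnA|exact: mulnC|exact: mul1n].
- exact: mul0n.
- by move=> a b c _; exact: mulnDr.
- by [].
- by move=> a b; rewrite /nat_null; case: a b => [|[|[|[|a]]]] [|[|[|[|b]]]] //=;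
  rewrite ?addnS.
- move=> a b; rewrite /nat_null; case: a b => [|[|[|[|a]]]] [|[|[|[|b]]]] //=;
  by rewrite ?mulSn ?mulnS ?addSn ?addnS ?mul0n ?muln0.
- by [].
- by [].
- by move=> a /nat_unit ->.
- move=> a b c d; rewrite mul1n /nat_null.
  case: a b c d => [|[|[|[|a]]]] [|[|[|[|b]]]] [|[|[|[|c]]]] [|[|[|[|d]]]] //=;
  by rewrite ?mulSn ?mulnS ?addSn ?addnS ?mul0n ?muln0.
- by move=> a b c d; rewrite mulnDr addnA.
Qed.

Definition nat_fuzzy_ring : fuzzy_ring := FuzzyRing nat_is_fuzzy_ring.

Lemma nat_funits_eq (u v : funits nat_fuzzy_ring) : u = v.
Proof.
by case: u v => a ua [b ub]; apply: eq_exist; rewrite (nat_unit ua) (nat_unit ub).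
Qed.

(** An isomorphism would force [H] to be [{0, 1}] and a sum of [n] ones to
    contain zero exactly when [n] is not one or three.  If [1 + 1] contained [1]
    then [1 + (1 + 1)] would contain [1 + 1], hence zero, which [n = 3] forbids.
    So [1 + 1 = {0}], and five ones have the same sum as three, which
    contradicts [n = 5]. *)
Lemma not_essentially_surjective_restrict_Fbar :
  ~ essentially_surjective (functor_comp restrict_units Fbar).
Proof.
move=> /(_ nat_fuzzy_ring) [H [f [g [gf _]]]].
have HP := hyperfieldP H.
have gK (u : funits (Fbar_ring H)) : g (f u) = u.
  exact: (congr1 (fun h => wm_fun h u) gf).
have f1 u : sval (f u) = 1 by apply: nat_unit; exact: (svalP (f u)).
pose u1 : funits (Fbar_ring H) := exist _ _ (Fbar_set1_unit (hf_one_neq0 HP)).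
have two_elements (x : H) : x <> hzero -> x = hone.
  move=> x0; apply: Fbar_set1_inj.
  pose u : funits (Fbar_ring H) := exist _ _ (Fbar_set1_unit x0).
  rewrite -[LHS]/(sval u) -[RHS]/(sval u1) -(gK u) -(gK u1); congr (sval (g _)).
  exact: nat_funits_eq.
have nullE n : nat_null n <-> hypersum (nseq n (hone : H)) hzero.
  have -> : hypersum (nseq n (hone : H)) =
     sval (\big[fadd/fzero]_(i < n) sval u1).
    rewrite Fbar_sumE big_const_ord; elim: n => [|n IHn] /=.
      by rewrite /hypersum big_nil.
    by rewrite hypersum_cons IHn.
  have natE : \big[fadd/fzero]_(i < n) sval (f u1) = n :> nat_fuzzy_ring.
    by rewrite f1 big_const_ord; elim: n => //= n ->.
  split=> [nn|/(wm_null f (a := fun=> u1))]; last by rewrite natE.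
  have : fnull (\big[fadd/fzero]_(i < n) sval (f u1)) by rewrite natE.
  by move=> /(wm_null g (a := fun=> f u1)); rewrite gK.
have sum2 : hypersum (nseq 2 (hone : H)) = hadd hone hone.
  rewrite !hypersum_cons /hypersum big_nil.
  by rewrite (hsaddC [set hone] [set hzero]) hsadd0 hsadd11.
have null2 : hadd hone hone (hzero : H) by rewrite -sum2; apply/nullE.
have null3 : ~ hypersum (nseq 3 (hone : H)) hzero by move=> /nullE.
have add11 : hadd hone hone = [set (hzero : H)].
  apply/seteqP; split=> [x|_ -> //].
  have [-> //|/two_elements -> one11] := pselect (x = hzero).
  case: null3; rewrite (nseqD 1 2) hypersum_cat sum2 /hypersum big_seq1.
  by apply/hsaddP; exists hone, hone.
apply: null3; have /nullE : nat_null 5 by [].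
by rewrite (nseqD 2 3) hypersum_cat sum2 add11 hsadd0.
Qed.

(** * Matroids *)

Section Matroids.
Variables (H : hyperfield_dd) (E : finType) (r : nat).

Definition Fbar_values (phi : r.-tuple E -> H) : r.-tuple E -> Fbar_ring H :=
  fun x => Fbar_set1 (phi x).

Lemma Fbar_values_inj : injective Fbar_values.
Proof.
by move=> phi psi /funeqP eq; apply/funext => x; apply: Fbar_set1_inj; exact: eq.
Qed.

(** Since [-1] corresponds to [eps], both sides of each axiom correspond; the
    Grassmann-Plucker sums are even equal as subsets of [H]. *)
Lemma hGP_Fbar_values (phi : r.-tuple E -> H) :
  hGP phi <-> fGP (Fbar_values phi).
Proof.
have set1_eq0 (x : H) : Fbar_set1 x = fzero :> Fbar_ring H <-> x = hzero.
  by split=> [/Fbar_set1_inj|->].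
have oppE (x : H) : Fbar_set1 (hopp x) = fmul feps (Fbar_set1 x : Fbar_ring H).
  by rewrite Fbar_set1M; congr Fbar_set1; rewrite hmulC hmulrN hmulC hmul1.
have relE (x : r.+1.-tuple E) (y : r.-1.-tuple E) :
    sval (\big[fadd/fzero]_(k < r.+1)
       fmul (iter k.+1 (fmul feps) fone)
         (fmul (Fbar_values phi (omit_tuple k x))
            (Fbar_values phi (Defs.cons_tuple (tnth x k) y)))) =
    \big[@hsadd H/[set hzero]]_(k < r.+1)
       [set hmul (iter k.+1 (hmul (hopp hone)) hone)
              (hmul (phi (omit_tuple k x)) (phi (Defs.cons_tuple (tnth x k) y)))].
  rewrite Fbar_sumE; apply: eq_bigr => k _.
  have -> : iter k.+1 (fmul feps) fone =
      Fbar_set1 (iter k.+1 (hmul (hopp hone)) hone) :> Fbar_ring H.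
    by elim: k.+1 => // n IHn; rewrite iterS IHn Fbar_set1M.
  by rewrite !Fbar_set1M.
split=> [[neq0 odd alt rel]|[_ neq0 odd alt rel]]; split.
- move=> x; have [/set1_eq0|/Fbar_set1_unit] := pselect (phi x = hzero).
    by right.
  by left.
- by have [x x0] := neq0; exists x => /set1_eq0.
- by move=> s x os; rewrite -oppE /Fbar_values odd.
- by move=> x ux; apply/set1_eq0; exact: alt.
- by move=> x y; rewrite /fnull /= /Fbar_null /= relE.
- by have [x x0] := neq0; exists x => /set1_eq0.
- by move=> s x os; apply: Fbar_set1_inj; rewrite oppE; exact: odd.
- by move=> x ux; apply/set1_eq0; exact: alt.
- by move=> x y; rewrite -relE; exact: rel.
Qed.

(** The units of [Fbar_ring H] are the singletons of nonzero elements, and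
    Grassmann-Plucker functions take values in units and zero. *)
Lemma fGP_factor (psi : r.-tuple E -> Fbar_ring H) :
  fGP psi -> exists phi, psi = Fbar_values phi.
Proof.
move=> psiP.
have /choice [phi phiE] : forall x, exists a, psi x = Fbar_set1 a.
  move=> x; case: (fGP_unit psiP x) => [/Fbar_unitE [a _ ->]|->].
    by exists a.
  by exists hzero.
by exists phi; apply/funext.
Qed.

Lemma hGP_equiv_Fbar_values (phi psi : r.-tuple E -> H) :
  hGP_equiv phi psi <-> fGP_equiv (Fbar_values phi) (Fbar_values psi).
Proof.
split=> [[u u0 ->]|[_ /Fbar_unitE [u u0 ->] /funeqP eq]].
  exists (Fbar_set1 u); first exact: Fbar_set1_unit.
  by apply/funext => x; rewrite Fbar_set1M.
exists u => //; apply/funext => x; apply: Fbar_set1_inj.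
by rewrite -Fbar_set1M; exact: eq.
Qed.

Lemma image_Fbar_values_class (phi : r.-tuple E -> H) :
  Fbar_values @` [set psi | hGP psi /\ hGP_equiv phi psi] =
  [set psi | fGP psi /\ fGP_equiv (Fbar_values phi) psi].
Proof.
apply/seteqP; split => [_ [psi [psiP e] <-]|psi [psiP e]] /=.
  by split; [apply/hGP_Fbar_values|apply/hGP_equiv_Fbar_values].
have [psi' eq] := fGP_factor psiP; rewrite eq in psiP e *.
by exists psi' => //; split; [apply/hGP_Fbar_values|apply/hGP_equiv_Fbar_values].
Qed.

Lemma hmatroid_fmatroid_bij :
  set_bij (@hmatroid H E r) (@fmatroid (Fbar_ring H) E r)
    (fun M => Fbar_values @` M).
Proof.
split.
- move=> _ [phi phiP ->] /=; exists (Fbar_values phi); first exact/hGP_Fbar_values.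
  exact: image_Fbar_values_class.
- move=> M N _ _ MN; apply/funext => phi.
  by rewrite -!(image_inj Fbar_values_inj) MN.
- move=> _ [psi psiP ->]; have [phi eq] := fGP_factor psiP.
  rewrite eq in psiP *.
  exists [set psi | hGP psi /\ hGP_equiv phi psi].
    by exists phi => //; apply/hGP_Fbar_values.
  exact: image_Fbar_values_class.
Qed.

End Matroids.

Theorem theorem4 :
  [/\ [/\ faithful Fbar, ~ full Fbar & ~ essentially_surjective Fbar],
      [/\ faithful (functor_comp restrict_units Fbar),
          ~ full (functor_comp restrict_units Fbar)
        & ~ essentially_surjective (functor_comp restrict_units Fbar)]
    & forall (H : hyperfield_dd) (E : finType) (r : nat),
        (0 < #|E|)%N -> (0 < r)%N ->
        set_bij (@hmatroid H E r) (@fmatroid (Fbar_ring H) E r)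
          (fun M => [set (fun x => Fbar_set1 (phi x)) | phi in M])].
Proof.
have noess := not_essentially_surjective_restrict_Fbar.
split; first split.
- exact: faithful_compr faithful_restrict_Fbar.
- apply: (@not_full_of_no_hom _ _ Fbar (bool_hyperfield false : Hyperfields_dd)).
    exact: no_strict_hom_F2_Krasner.
  exact: F2_to_Krasner.
- move=> Fs; apply: noess; apply: essentially_surjective_comp => //.
  exact: essentially_surjective_restrict_units.
- split => //; first exact: faithful_restrict_Fbar.
  apply: (@not_full_of_no_hom _ _ (functor_comp restrict_units Fbar)
    (bool_hyperfield false : Hyperfields_dd)).
    exact: no_strict_hom_F2_Krasner.
  exact: restrict_units_hom F2_to_Krasner.
- by move=> H E r _ _; exact: hmatroid_fmatroid_bij.
Qed.
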